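(* Suppose that $V$ is a base point free linear series of forms of degree $d$ on $\mathbf P^{n-1}$. Suppose that the free resolution of the ideal $I$ generated by $V$ is linear for at least $\lceil n/2\rceil$ steps. Let $\phi$ be the presentation matrix of $I$. If $\psi$ is the adjoint matrix of $\phi$, then the annihilator of $\operatorname{coker}\psi$ is the ideal of forms in $\mathbf P(V)$ that vanish on the image of $\mathbf P^{n-1}$ under the rational map associated to $|V|$.
   Context: $K$ is a field, $S=K[x_1,\dots,x_n]$ is the polynomial ring graded with $\deg x_i=1$, the homogeneous coordinate ring of $\mathbf P^{n-1}$. $V\subset S_d$ is a vector space with basis $f_1,\dots,f_N$, and $I=SV$; base point free means that $I$ is $(x_1,\dots,x_n)$-primary. The map associated to $|V|$ is $\mathbf P^{n-1}\to\mathbf P(V)=\mathbf P^{N-1}$, $x\mapsto(f_1(x):\dots:f_N(x))$; the homogeneous coordinate ring of $\mathbf P(V)$ is $K[T_1,\dots,T_N]$ and the ideal of forms vanishing on the image is the kernel of $K[T_1,\dots,T_N]\to S$, $T_i\mapsto f_i$. The resolution of $I$ is linear for $q$ steps if for $0\le i\le q$ the $i$-th free module in the minimal graded free resolution of $I$ (starting with $i=0$ for the generators) is generated in degree $d+i$. The (minimal) presentation matrix $\phi$ of $I$ with respect to the generators $f_1,\dots,f_N$ is then an $N\times M$ matrix of linear forms in $S$; the adjoint (Jacobian dual) matrix $\psi$ is the $n\times M$ matrix of linear forms in $K[T_1,\dots,T_N]$ determined by $(T_1,\dots,T_N)\,\phi=(x_1,\dots,x_n)\,\psi$ (the two matrices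 represent the same $n\times N\times M$ tensor over $K$). $\operatorname{coker}\psi$ is a $K[T_1,\dots,T_N]$-module, the cokernel of $\psi:K[T]^M\to K[T]^n$. *)

(* Defs.v *)
From HB Require Import structures.
From mathcomp Require Import all_boot all_order all_algebra.
From mathcomp Require Import mpoly.

Set Implicit Arguments.
Unset Strict Implicit.
Unset Printing Implicit Defensive.

Import GRing.Theory.
Local Open Scope ring_scope.

Section Ideals.
Variable R : comNzRingType.

Definition ideal_gen (A : R -> Prop) (p : R) : Prop :=
  exists (m : nat) (c a : 'I_m -> R),
    (forall i, A (a i)) /\ p = \sum_(i < m) c i * a i.

Definition radical (I : R -> Prop) (p : R) : Prop :=
  exists k : nat, I (p ^+ k).

Definition primary_ideal (I : R -> Prop) : Prop :=
  ~ I 1 /\ forall a b, I (a * b) -> I a \/ radical I b.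

Definition primary_to (P I : R -> Prop) : Prop :=
  primary_ideal I /\ forall p, radical I p <-> P p.

(** Free modules are modules of column vectors; a matrix acts by left
    multiplication, so its columns are the images of the basis vectors. *)

Definition exact_at m n p (A : 'M[R]_(m, n)) (B : 'M[R]_(n, p)) : Prop :=
  forall v : 'cV[R]_n, A *m v = 0 <-> exists w : 'cV[R]_p, v = B *m w.

(** [p] kills every class of the quotient of [R^m] by the column space. *)
Definition ann_coker m n (A : 'M[R]_(m, n)) (p : R) : Prop :=
  forall v : 'cV[R]_m, exists w : 'cV[R]_n, p *: v = A *m w.

End Ideals.

Section Graded.
Variables (K : fieldType) (n : nat).
Local Notation S := {mpoly K[n]}.

Definition irrelevant_ideal : S -> Prop :=
  ideal_gen (fun p : S => exists i : 'I_n, p = 'X_i).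

(** [A] is a degree 0 map from the free module with basis degrees [b] to the
    one with basis degrees [a]: the entry (i, j) is homogeneous of degree
    [b j - a i], hence 0 when this is negative. *)
Definition graded_mx r s (a : 'I_r -> nat) (b : 'I_s -> nat)
    (A : 'M[S]_(r, s)) : Prop :=
  forall i j (m : 'X_{1..n}), m \in msupp (A i j) -> (a i + mdeg m)%N = b j.

Definition minimal_mx r s (A : 'M[S]_(r, s)) : Prop :=
  forall i j, irrelevant_ideal (A i j).

(** ... -> F_1 -> F_0 -> S, where [F_i] is free with basis degrees [gdeg i];
    the indexing starts with [F_0] for the generators of the ideal. *)
Record free_complex := FreeComplex {
  rank : nat -> nat;
  gdeg : forall i, 'I_(rank i) -> nat;
  aug : 'rV[S]_(rank 0);
  diff : forall i, 'M[S]_(rank i, rank i.+1)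
}.

Definition minimal_free_resolution (I : S -> Prop) (F : free_complex) : Prop :=
  [/\ graded_mx (fun _ => 0%N) (@gdeg F 0) (aug F)
        /\ (forall i, graded_mx (@gdeg F i) (@gdeg F i.+1) (diff F i)),
      forall p : S, I p <-> exists w : 'cV[S]_(rank F 0), p%:M = aug F *m w,
      exact_at (aug F) (diff F 0),
      forall i, exact_at (diff F i) (diff F i.+1)
    & forall i, minimal_mx (diff F i)].

(** The minimal graded free resolution is unique up to isomorphism, so [exists]
    expresses a property of "the" resolution. *)
Definition linear_for_steps (d q : nat) (I : S -> Prop) : Prop :=
  exists2 F : free_complex, minimal_free_resolution I F &
    forall i : nat, (i <= q)%N -> forall j, @gdeg F i j = (d + i)%N.

(** The last clause says that the columns of [phi] minimally generate the
    syzygies: no relation among them has a coefficient outside the irrelevant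
    ideal. *)
Definition minimal_presentation N M (d : nat) (f : 'rV[S]_N)
    (phi : 'M[S]_(N, M)) : Prop :=
  [/\ exists e : 'I_M -> nat, graded_mx (fun _ => d) e phi,
      exact_at f phi,
      minimal_mx phi
    & forall w : 'cV[S]_M, phi *m w = 0 -> minimal_mx w].

End Graded.

Section Adjoint.
Variables (K : fieldType) (n N M : nat).

(** K[x_1..x_n] and K[T_1..T_N] inside K[x_1..x_n, T_1..T_N]. *)
Definition x_inj (p : {mpoly K[n]}) : {mpoly K[n + N]} :=
  comp_mpoly [tuple 'X_(lshift N i) | i < n] p.

Definition T_inj (p : {mpoly K[N]}) : {mpoly K[n + N]} :=
  comp_mpoly [tuple 'X_(rshift n i) | i < N] p.

(** (T_1, ..., T_N) phi = (x_1, ..., x_n) psi. *)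
Definition adjoint_matrix (phi : 'M[{mpoly K[n]}]_(N, M))
    (psi : 'M[{mpoly K[N]}]_(n, M)) : Prop :=
  (forall k j, psi k j \is 1.-homog) /\
  (\row_i T_inj 'X_i) *m map_mx x_inj phi =
  (\row_k x_inj 'X_k) *m map_mx T_inj psi.

End Adjoint.

Section LinearSeries.
Variables (K : fieldType) (n d : nat).

(** The library gives the space of forms of degree [d] its finite-dimensional
    structure only in a positive number [n.+1] of variables: the linear series
    lives on the projective space of dimension [n]. *)
Definition series_ideal (V : {vspace dhomog n.+1 K d}) :
    {mpoly K[n.+1]} -> Prop :=
  ideal_gen (fun p : {mpoly K[n.+1]} =>
    exists2 v : dhomog n.+1 K d, v \in V & p = v).

Definition base_point_free (V : {vspace dhomog n.+1 K d}) : Prop :=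
  primary_to (@irrelevant_ideal K n.+1) (series_ideal V).

Definition forms_row N (f : N.-tuple (dhomog n.+1 K d)) :
    'rV[{mpoly K[n.+1]}]_N :=
  \row_i (tnth f i : {mpoly K[n.+1]}).

(** The kernel of K[T_1..T_N] -> K[x], T_i |-> f_i. *)
Definition image_ideal N (f : N.-tuple (dhomog n.+1 K d))
    (p : {mpoly K[N]}) : Prop :=
  comp_mpoly [tuple (tnth f i : {mpoly K[n.+1]}) | i < N] p = 0.

End LinearSeries.

(* Main.v *)
Require Import Defs.
From HB Require Import structures.
From mathcomp Require Import all_boot all_order all_algebra.
From mathcomp Require Import mpoly.
From mathcomp Require Import ssrAC zify.

Set Implicit Arguments.
Unset Strict Implicit.
Unset Printing Implicit Defensive.

Import GRing.Theory.
Local Open Scope ring_scope.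

(** Let [S = K[x_0..x_n]], [A = S / I], and let [ev : K[T] -> S] be the
    substitution [T_i := f_i]. The cokernel of [psi] is the part of degree 1 in
    [x] of [Sym I = K[x, T] / (T phi)], and it maps onto the part of degree 1 in
    [x] of the Rees algebra of [I] by [v |-> \sum_k x_k ev (v_k)].

    If [p] kills [coker psi], then [x_0 ev p = 0], hence [ev p = 0]
    ([ann_coker_image]).

    Conversely, it is enough to show that [v] of degree [t >= 2] in [T] with
    [\sum_k x_k ev (v_k) = 0] lies in the image of [psi] ([sym_rees_injective]):
    apply this to [v = p e_k], where [p] is a homogeneous element of the kernel
    of [ev]; such a [p] vanishes when it has degree at most 1, because the [f_i]
    are linearly independent. For [t >= 3] write [v = \sum_i T_i v_i]. The forms
    [\sum_k x_k ev (v_ik)] are a syzygy of the [f_i], so they are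
    [phi w] with [w] of degree [d (t - 1)]. Every form of this degree is in the
    image of [ev] ([ev_surj]), so [w = ev u]; subtracting from the [v_i] the
    contribution of [u], which lies in the image of [psi], one reduces to degree
    [t - 1].

    Three facts remain, about forms of high degree. They are the vanishing of
    [Tor_0(A, A)] and [Tor_1(A, A)] in degree [2d] (and [Tor_0] above), which
    give [S_e = I_e] for [e >= 2d] and [S_(2d) = V^2], hence [ev_surj]; and the
    vanishing of [Tor_2(A, A)] in degree [2d + 1], which gives the case [t = 2]:
    a matrix [L] of linear forms with [f L f^T = 0] is [phi W + W' phi^T].

    All three come from [cycle_is_boundary]. Truncate the resolution of [A]
    where it stops being linear and take the tensor square of the truncation.
    Since [A] is killed by the powers [x_j ^ s], multiplication by [x_j ^ 2s] on
    the tensor square is null-homotopic below its top total degree. Apply the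
    [n + 1] homotopies, one for each variable, to a cycle [z]. The result lies
    [n + 1] steps higher, where linearity bounds the degrees of the generators,
    so that its coefficients have a degree which forces every monomial to be
    divisible by some [x_j ^ 2s]. As these powers form a regular sequence, this
    divisibility can be carried back down, one variable at a time, to show that
    [z] is a boundary: an elementary form of the computation of [Tor] by local
    cohomology with supports in the irrelevant ideal. The truncation can be made
    at step [ceil ((n + 1) / 2)] of the resolution of [I] because the two factors
    share the total degree, which is at most [n + 3]. *)

(** * Homogeneous components of polynomials and matrices *)

Section Degrees.
Variables (K : fieldType) (n : nat).
Local Notation S := {mpoly K[n]}.
Implicit Types (p q : S) (b : bool) (c : int).

(** For [b = true], [p] is homogeneous of degree [c]; for [b = false], its
    component of degree [c] vanishes. Both are stable under the same operations,
    so one set of lemmas serves to compare homogeneous components without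
    projecting on them. Degrees are integers because the degree of a matrix entry
    is a difference of degrees of generators. *)
Definition indeg b c p : Prop :=
  forall m, m \in msupp p -> ((mdeg m)%:Z == c) = b.

Lemma indeg0 b c : indeg b c 0.
Proof. by move=> m; rewrite msupp0. Qed.

Lemma indegD b c p q : indeg b c p -> indeg b c q -> indeg b c (p + q).
Proof.
by move=> hp hq m /msuppD_le; rewrite mem_cat => /orP[/hp|/hq].
Qed.

Lemma indegN b c p : indeg b c p -> indeg b c (- p).
Proof. by move=> hp m; rewrite (perm_mem (msuppN p)) => /hp. Qed.

Lemma indegB b c p q : indeg b c p -> indeg b c q -> indeg b c (p - q).
Proof. by move=> hp hq; apply: indegD => //; apply: indegN. Qed.

Lemma indeg_sum (I : Type) (r : seq I) (P : pred I) (F : I -> S) b c :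
  (forall i, P i -> indeg b c (F i)) -> indeg b c (\sum_(i <- r | P i) F i).
Proof. by move=> hF; elim/big_ind: _ => //; [exact: indeg0 | exact: indegD]. Qed.

Lemma indegM b c c' p q :
  indeg true c p -> indeg b c' q -> indeg b (c + c') (p * q).
Proof.
move=> hp hq m /msuppM_le /allpairsP[[m1 m2] /= [/hp + /hq + ->]].
rewrite mdegD => /eqP <- <-; lia.
Qed.

Lemma indegMr b c c' p q :
  indeg b c p -> indeg true c' q -> indeg b (c + c') (p * q).
Proof. by move=> hp hq; rewrite mulrC addrC; apply: indegM. Qed.

Lemma indegZ b c (a : K) p : indeg b c p -> indeg b c (a *: p).
Proof. by move=> hp m /msuppZ_le /hp. Qed.

Lemma indegX (m : 'X_{1..n}) : indeg true (mdeg m)%:Z 'X_[m].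
Proof. by move=> m' /mem_msuppXP <-; rewrite eqxx. Qed.

Lemma indegC (a : K) : indeg true 0 a%:MP.
Proof.
by move=> m; rewrite msuppC; case: eqP => // _; rewrite inE => /eqP ->;
   rewrite mdeg0.
Qed.

Lemma indeg_var_pow (i : 'I_n) (s : nat) : indeg true s ('X_i ^+ s).
Proof.
by rewrite mpolyXn; have := @indegX (U_(i) *+ s)%MM; rewrite mdegMn mdeg1 mul1n.
Qed.

Lemma indeg_true_false c p : indeg true c p -> indeg false c p -> p = 0.
Proof.
move=> hp hq; apply/msuppnil0; case E: (msupp p) => [//|m s].
have mp : m \in msupp p by rewrite E mem_head.
by have := hp m mp; rewrite (hq m mp).
Qed.

Lemma indeg_neq c c' p : indeg true c p -> c != c' -> indeg false c' p.
Proof. by move=> hp cc m /hp /eqP ->; apply/negbTE. Qed.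

Lemma dhomog_indeg (k : nat) p : p \is k.-homog -> indeg true k%:Z p.
Proof. by move=> /dhomogP hp m /hp ->; rewrite eqxx. Qed.

Lemma indeg_dhomog (k : nat) p : indeg true k%:Z p -> p \is k.-homog.
Proof. by move=> hp; apply/dhomogP => m /hp /eqP[]. Qed.

Lemma indeg_const p : indeg true 0 p -> p = (p@_0%MM)%:MP.
Proof.
move=> /(@indeg_dhomog 0) /dhomogP hp; apply/mpolyP => m; rewrite mcoeffC.
have [->|nm] := eqVneq m 0%MM; first by rewrite mulr1.
rewrite mulr0; apply/eqP; rewrite mcoeff_eq0.
by apply: contra nm => /hp /eqP; rewrite mdeg_eq0.
Qed.

Lemma msupp_filter_sum (P : pred 'X_{1..n}) p :
  {subset msupp (\sum_(m <- msupp p | P m) p@_m *: 'X_[m]) <=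
    [pred m | P m & m \in msupp p]}.
Proof.
move=> m; rewrite mcoeff_msupp; apply: contraR => nm.
rewrite raddf_sum /= big_seq_cond big1 // => m' /andP[m'p Pm'].
rewrite mcoeffZ mcoeffX; case: eqP => [E|]; last by rewrite mulr0.
by rewrite -E inE Pm' m'p in nm.
Qed.

Lemma mpoly_split (P : pred 'X_{1..n}) p :
  p = \sum_(m <- msupp p | P m) p@_m *: 'X_[m]
      + \sum_(m <- msupp p | ~~ P m) p@_m *: 'X_[m].
Proof. by rewrite {1}[p]mpolyE (bigID P). Qed.

Lemma indeg_split c p : exists q r, [/\ p = q + r, indeg true c q, indeg false c r
  & {subset msupp r <= msupp p}].
Proof.
pose P := [pred m : 'X_{1..n} | (mdeg m)%:Z == c].
exists (\sum_(m <- msupp p | P m) p@_m *: 'X_[m]).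
exists (\sum_(m <- msupp p | ~~ P m) p@_m *: 'X_[m]).
split; first exact: mpoly_split.
- by move=> m /msupp_filter_sum /andP[/= ->].
- by move=> m /(msupp_filter_sum (P := predC P)) /andP[/= /negbTE ->].
- by move=> m /(msupp_filter_sum (P := predC P)) /andP[].
Qed.

Definition indegmx b c r s (A : 'M[S]_(r, s)) := forall i j, indeg b c (A i j).

Lemma indegmx0 b c r s : indegmx b c (0 : 'M_(r, s)).
Proof. by move=> i j; rewrite mxE; apply: indeg0. Qed.

Lemma indegmxD b c r s (A B : 'M_(r, s)) :
  indegmx b c A -> indegmx b c B -> indegmx b c (A + B).
Proof. by move=> hA hB i j; rewrite mxE; apply: indegD. Qed.

Lemma indegmxN b c r s (A : 'M_(r, s)) : indegmx b c A -> indegmx b c (- A).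
Proof. by move=> hA i j; rewrite mxE; apply: indegN. Qed.

Lemma indegmx_sign b c r s (k : nat) (A : 'M_(r, s)) :
  indegmx b c A -> indegmx b c ((-1) ^+ k *: A).
Proof.
move=> hA; rewrite -signr_odd; case: odd; rewrite ?scale1r //.
by rewrite scaleN1r; apply: indegmxN.
Qed.

Lemma indegmxM b c c' r s t (A : 'M_(r, s)) (B : 'M_(s, t)) :
  indegmx true c A -> indegmx b c' B -> indegmx b (c + c') (A *m B).
Proof. by move=> hA hB i j; rewrite mxE; apply: indeg_sum => k _; apply: indegM. Qed.

Lemma indegmxMr b c c' r s t (A : 'M_(r, s)) (B : 'M_(s, t)) :
  indegmx b c A -> indegmx true c' B -> indegmx b (c + c') (A *m B).
Proof. by move=> hA hB i j; rewrite mxE; apply: indeg_sum => k _; apply: indegMr. Qed.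

Lemma indegmxZ b c c' r s p (A : 'M_(r, s)) :
  indeg true c p -> indegmx b c' A -> indegmx b (c + c') (p *: A).
Proof. by move=> hp hA i j; rewrite mxE; apply: indegM. Qed.

Lemma indegmxT b c r s (A : 'M_(r, s)) : indegmx b c A -> indegmx b c A^T.
Proof. by move=> hA i j; rewrite mxE. Qed.

Lemma indegmx_scalar b c r p : indeg b c p -> indegmx b c (p%:M : 'M_r).
Proof.
move=> hp i j; rewrite mxE; case: eqP => _; first by rewrite mulr1n.
by rewrite mulr0n; apply: indeg0.
Qed.

Lemma indegmx_split c r s (A : 'M[S]_(r, s)) :
  exists B C, [/\ A = B + C, indegmx true c B & indegmx false c C].
Proof.
have /fin_all_exists[F hF] : forall ij : 'I_r * 'I_s, exists qr : S * S,
    [/\ A ij.1 ij.2 = qr.1 + qr.2, indeg true c qr.1 & indeg false c qr.2].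
  by move=> ij; have [q [r' [? ? ? _]]] := indeg_split c (A ij.1 ij.2); exists (q, r').
exists (\matrix_(i, j) (F (i, j)).1), (\matrix_(i, j) (F (i, j)).2); split.
- by apply/matrixP => i j; rewrite !mxE; case: (hF (i, j)).
- by move=> i j; rewrite mxE; case: (hF (i, j)).
- by move=> i j; rewrite mxE; case: (hF (i, j)).
Qed.

Lemma indegmx_true_false c r s (A : 'M[S]_(r, s)) :
  indegmx true c A -> indegmx false c A -> A = 0.
Proof.
by move=> h1 h2; apply/matrixP => i j; rewrite mxE; apply: (indeg_true_false (c := c)).
Qed.

(** A lift of a homogeneous matrix through a homogeneous matrix can be taken
    homogeneous: keep only its component of the right degree. *)
Lemma indegmx_factor c c' r s t (A : 'M[S]_(r, s)) (V : 'M_(r, t)) (W : 'M_(s, t)) :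
  indegmx true c A -> indegmx true (c + c') V -> V = A *m W ->
  exists2 W', indegmx true c' W' & V = A *m W'.
Proof.
move=> hA hV VE; have [B [C [WE hB hC]]] := indegmx_split c' W.
exists B => //; apply/eqP; rewrite -subr_eq0; apply/eqP.
apply: (indegmx_true_false (c := c + c')).
  by apply: indegmxD => //; apply/indegmxN/indegmxM.
by rewrite VE WE mulmxDr addrAC subrr add0r; apply: indegmxM.
Qed.

End Degrees.

(** * The ideals generated by powers of the first variables *)

Section PowerIdeal.
Variables (K : fieldType) (n : nat).
Local Notation S := {mpoly K[n.+1]}.
Implicit Types (p q : S).

(** The ideal generated by the [x_i ^ s] with [i < k]; a monomial ideal is
    determined by its monomials. *)
Definition in_powers (s k : nat) p : Prop :=
  forall m, m \in msupp p -> exists2 i : 'I_n.+1, (i < k)%N & (s <= m i)%N.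

Variable s : nat.

Lemma in_powers0 k : in_powers s k 0.
Proof. by move=> m; rewrite msupp0. Qed.

Lemma in_powersD k p q :
  in_powers s k p -> in_powers s k q -> in_powers s k (p + q).
Proof.
by move=> hp hq m /msuppD_le; rewrite mem_cat => /orP[/hp|/hq].
Qed.

Lemma in_powersN k p : in_powers s k p -> in_powers s k (- p).
Proof. by move=> hp m; rewrite (perm_mem (msuppN p)) => /hp. Qed.

Lemma in_powersM k p q : in_powers s k q -> in_powers s k (p * q).
Proof.
move=> hq m /msuppM_le /allpairsP[[m1 m2] /= [_ /hq [i ik sm] ->]].
by exists i => //; rewrite mnmDE (leq_trans sm) // leq_addl.
Qed.

Lemma in_powers_sum (I : Type) (r : seq I) (P : pred I) (F : I -> S) k :
  (forall i, P i -> in_powers s k (F i)) -> in_powers s k (\sum_(i <- r | P i) F i).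
Proof. by move=> hF; elim/big_ind: _ => //; [exact: in_powers0 | exact: in_powersD]. Qed.

Lemma in_powers_leq0 p : in_powers s 0 p -> p = 0.
Proof.
move=> hp; apply/msuppnil0; case E: (msupp p) => [//|m r].
by have [|i] := hp m; rewrite ?E ?mem_head.
Qed.

Lemma in_powersW k k' p : (k <= k')%N -> in_powers s k p -> in_powers s k' p.
Proof. by move=> kk hp m /hp[i ik ?]; exists i => //; apply: leq_trans kk. Qed.

Lemma in_powersX (i : 'I_n.+1) : in_powers s i.+1 ('X_i ^+ s).
Proof.
rewrite mpolyXn => m /mem_msuppXP <-; exists i => //.
by rewrite mulmnE mnm1E eqxx mul1n.
Qed.

(** The powers [x_0 ^ s, x_1 ^ s, ...] form a regular sequence: multiplying a
    monomial by [x_i ^ s] does not change its exponents at the indices below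
    [i]. *)
Lemma in_powers_reg (i : 'I_n.+1) p :
  in_powers s i ('X_i ^+ s * p) -> in_powers s i p.
Proof.
rewrite mpolyXn => hp m mp.
have [|j ji sm] := hp (U_(i) *+ s + m)%MM.
  by rewrite mulrC (perm_mem (msuppMX _ _)); apply: map_f.
exists j => //; move: sm; rewrite mnmDE mulmnE mnm1E.
by case: eqVneq ji => [->|_]; rewrite ?ltnn ?mul0n.
Qed.

(** Division by [x_i ^ s] is given by functions, so that it extends at once to
    infinite families of matrices. *)
Definition power_quot (i : 'I_n.+1) p : S :=
  \sum_(m <- msupp p | (s <= m i)%N) p@_m *: 'X_[m - U_(i) *+ s].

Definition power_rem (i : 'I_n.+1) p : S :=
  \sum_(m <- msupp p | ~~ (s <= m i)%N) p@_m *: 'X_[m].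

Lemma power_divE i p : p = 'X_i ^+ s * power_quot i p + power_rem i p.
Proof.
rewrite {1}[p](mpoly_split (fun m => s <= m i)%N) mulr_sumr; congr (_ + _).
apply: eq_bigr => m Pm; rewrite -scalerAr mpolyXn -mpolyXD; congr (_ *: 'X_[_]).
apply/mnmP => j; rewrite mnmDE mnmBE mulmnE mnm1E.
case: eqVneq => [<-|_]; last by rewrite mul0n subn0.
by rewrite mul1n subnKC.
Qed.

Lemma in_powers_rem (i : 'I_n.+1) p :
  in_powers s i.+1 p -> in_powers s i (power_rem i p).
Proof.
move=> hp m /(msupp_filter_sum (P := fun m => ~~ (s <= m i)%N)) /andP[/= Pm /hp[j]].
rewrite ltnS leq_eqVlt => /orP[/eqP/val_inj ->|]; last by exists j.
by rewrite (negbTE Pm).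
Qed.

(** If all exponents of a monomial are at most [s - 1], then its degree is at
    most [(n + 1) (s - 1)]. *)
Lemma in_powers_deg p :
  (forall m, m \in msupp p -> (n.+1 * s < mdeg m + n.+1)%N) ->
  in_powers s n.+1 p.
Proof.
move=> hp m /hp; have [/existsP[i]|/existsPn h] := boolP [exists i, (s <= m i)%N].
  by exists i.
rewrite mdegE => lt; exfalso.
have: (\sum_(i < n.+1) (m i).+1 <= \sum_(i < n.+1) s)%N.
  by apply: leq_sum => i _; rewrite ltnNge.
rewrite sum_nat_const card_ord.
under eq_bigr do rewrite -addn1.
by rewrite big_split /= sum_nat_const card_ord muln1 leqNgt lt.
Qed.

Definition powmx k a b (A : 'M[S]_(a, b)) := forall i j, in_powers s k (A i j).

Lemma powmxD k a b (A B : 'M_(a, b)) : powmx k A -> powmx k B -> powmx k (A + B).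
Proof. by move=> hA hB i j; rewrite mxE; apply: in_powersD. Qed.

Lemma powmxN k a b (A : 'M_(a, b)) : powmx k A -> powmx k (- A).
Proof. by move=> hA i j; rewrite mxE; apply: in_powersN. Qed.

Lemma powmxZ k a b p (A : 'M_(a, b)) : powmx k A -> powmx k (p *: A).
Proof. by move=> hA i j; rewrite mxE; apply: in_powersM. Qed.

Lemma powmxM k a b c (A : 'M_(a, b)) (B : 'M_(b, c)) : powmx k B -> powmx k (A *m B).
Proof.
by move=> hB i j; rewrite mxE; apply: in_powers_sum => l _; apply: in_powersM.
Qed.

Lemma powmxMr k a b c (A : 'M_(a, b)) (B : 'M_(b, c)) : powmx k A -> powmx k (A *m B).
Proof.
move=> hA i j; rewrite mxE; apply: in_powers_sum => l _; rewrite mulrC.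
exact: in_powersM.
Qed.

Lemma powmx_divE (i : 'I_n.+1) a b (A : 'M[S]_(a, b)) :
  A = 'X_i ^+ s *: map_mx (power_quot i) A + map_mx (power_rem i) A.
Proof. by apply/matrixP => k l; rewrite !mxE -power_divE. Qed.

Lemma powmx_rem (i : 'I_n.+1) a b (A : 'M[S]_(a, b)) :
  powmx i.+1 A -> powmx i (map_mx (power_rem i) A).
Proof. by move=> hA k l; rewrite mxE; apply: in_powers_rem. Qed.

Lemma powmx_reg (i : 'I_n.+1) a b (A : 'M[S]_(a, b)) :
  powmx i ('X_i ^+ s *: A) -> powmx i A.
Proof.
by move=> hA k l; apply: in_powers_reg; move: (hA k l); rewrite mxE.
Qed.

End PowerIdeal.

(** * Homotopies on the tensor square of a truncated complex *)

(** The computation behind [htpy_bd], for one entry. If [h] is a homotopy from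
    [x - P] to 0 and [g] one from [x - Q] to 0, then
    [x (h (x) 1) + P (x) g] is, up to sign, a homotopy from
    [x^2 - P (x) Q] to 0. Here [P1] and [P2] are two components of [P], while
    [eq0], [eq1], [gq0], [gq1] are transposed components of the differential and
    of the homotopy of the second factor. *)
Lemma htpy_identity (R : comNzRingType) (k m0 m1 m2 n0 n1 n2 : nat) (x : R)
    (dp : 'M_(m0, m1)) (dp1 : 'M_(m1, m2)) (hp : 'M_(m1, m0)) (hp1 : 'M_(m2, m1))
    (P1 : 'M_m1) (P2 : 'M_m2)
    (eq0 : 'M_(n1, n0)) (eq1 : 'M_(n2, n1)) (gq0 : 'M_(n0, n1)) (gq1 : 'M_(n1, n2))
    (Q : 'M_n1) (X11 : 'M_(m1, n1)) (X20 : 'M_(m2, n0)) (X02 : 'M_(m0, n2)) :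
  dp1 *m hp1 + hp *m dp = x%:M - P1 ->
  gq1 *m eq1 + eq0 *m gq0 = x%:M - Q ->
  dp1 *m P2 = P1 *m dp1 ->
  P1 *m X11 *m Q = 0 ->
  (dp1 *m (x *: (hp1 *m X11) + (-1) ^+ k.+2 *: (P2 *m X20 *m gq0))
   + (-1) ^+ k.+1 *:
       ((x *: (hp *m X02) + (-1) ^+ k.+1 *: (P1 *m X11 *m gq1)) *m eq1))
  + (x *: (hp *m (dp *m X11 + (-1) ^+ k *: (X02 *m eq1)))
   + (-1) ^+ k.+1 *:
       (P1 *m (dp1 *m X20 + (-1) ^+ k.+1 *: (X11 *m eq0)) *m gq0))
  = (x * x) *: X11.
Proof.
move=> B C D0 kill.
rewrite !exprS !mulN1r opprK.
have: (-1) ^+ k * (-1) ^+ k = 1 :> R by rewrite -exprMn mulrNN mulr1 expr1n.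
move: ((-1) ^+ k) => e ee.
rewrite !mulmxDr !mulmxDl -!scalemxAr -!scalemxAl !scalerDr !scalerA !mulmxA.
rewrite !mulrNN ?ee D0 !scale1r mulNr (mulrC e x) !scaleNr.
have E1 : dp1 *m hp1 *m X11 + hp *m dp *m X11 = x *: X11 - P1 *m X11.
  by rewrite -mulmxDl B mulmxBl mul_scalar_mx.
have E2 : P1 *m X11 *m gq1 *m eq1 + P1 *m X11 *m eq0 *m gq0 = x *: (P1 *m X11).
  by rewrite -!(mulmxA (P1 *m X11)) -mulmxDr C mulmxBr kill subr0 mul_mx_scalar.
rewrite (AC ((2*2)*(2*2)) ((1*5)*(4*8)*(2*7)*(3*6)))%AC /=.
by rewrite subrr addNr !addr0 -scalerDr E1 E2 -scalerDr subrK scalerA.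
Qed.

Section TensorSquare.
Variables (K : fieldType) (n : nat).
Local Notation S := {mpoly K[n.+1]}.
Variables (r : nat -> nat) (d : forall p, 'M[S]_(r p, r p.+1)).
Variables (a s : nat) (h : 'I_n.+1 -> forall p, 'M[S]_(r p.+1, r p)).
Variable t : nat -> int.

(** The endomorphism to which [h j] connects multiplication by [x_j ^ s]. It is
    a morphism of complexes, by [d_hdefect], that vanishes below the truncation
    degree [a]. *)
Definition hdefect j p : 'M[S]_(r p) :=
  match p with
  | 0 => 0
  | p'.+1 => ('X_j ^+ s)%:M - d p'.+1 *m h j p'.+1 - h j p' *m d p'
  end.

(* The complex starts in degree 1, so that p.+1 and q.+1 are the only indices at
   which the two predecessors in [htpy] have to exist. *)
Hypothesis r0 : r 0 = 0%N.
Hypothesis dd : forall p, d p *m d p.+1 = 0.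
Hypothesis h_top : forall j p, (a <= p)%N -> h j p = 0.
Hypothesis h_htpy : forall j p, (p < a)%N -> hdefect j p = 0.
Hypothesis d_deg : forall p, indegmx true (t p.+1 - t p) (d p).
Hypothesis h_deg : forall j p, indegmx true (s%:Z + t p - t p.+1) (h j p).

(** An element of the tensor square: the entry [(p, q)] is a tensor in
    [F_p (x) F_q] written as a matrix, on which the differentials act by
    multiplication on the left and by transposed multiplication on the right. *)
Definition bifamily := forall p q, 'M[S]_(r p, r q).
Implicit Types X Y Z : bifamily.

Definition bd X : bifamily :=
  fun p q => d p *m X p.+1 q + (-1) ^+ p *: (X p q.+1 *m (d q)^T).

Definition htpy j X : bifamily := fun p q =>
  match p, q return 'M[S]_(r p, r q) with
  | p'.+1, q'.+1 =>
      'X_j ^+ s *: (h j p' *m X p' q'.+1)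
      + (-1) ^+ p'.+1 *: (hdefect j p'.+1 *m X p'.+1 q' *m (h j q')^T)
  | _, _ => 0
  end.

(** Homological degree [l] in the tensor square of the truncation at [a]. *)
Definition placed l X := forall p q,
  X p q = 0 \/ [/\ (p <= a)%N, (q <= a)%N & (p + q)%N = l].

(** Internal degree [e], the generators of [F_p] having degree [t p]. *)
Definition indegfam e X := forall p q, indegmx true (e - t p - t q) (X p q).

(** The exponent is [s + s] because the homotopies [htpy] are for [x_j ^ 2s]. *)
Definition powfam k X := forall p q, powmx (s + s) k (X p q).

Lemma empty_rows q (A B : 'M[S]_(r 0, q)) : A = B.
Proof. by apply/matrixP => i; have := ltn_ord i; rewrite {2}r0. Qed.

Lemma empty_cols q (A B : 'M[S]_(q, r 0)) : A = B.
Proof. by apply/matrixP => ? i; have := ltn_ord i; rewrite {2}r0. Qed.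

Lemma bd_bd X p q : bd (bd X) p q = 0.
Proof.
rewrite /bd mulmxDr mulmxDl -!scalemxAr -!scalemxAl !mulmxA dd mul0mx add0r.
rewrite -[(_ *m (d q.+1)^T) *m _]mulmxA -trmx_mul dd trmx0 mulmx0 scaler0 addr0.
by rewrite exprS mulN1r scaleNr addNr.
Qed.

Lemma bd_add X A B p q : (forall p q, X p q = A p q + B p q) ->
  bd X p q = bd A p q + bd B p q.
Proof. by move=> E; rewrite /bd !E mulmxDr mulmxDl scalerDr addrACA. Qed.

Lemma bd_scale x X p q : bd (fun p q => x *: X p q) p q = x *: bd X p q.
Proof.
by rewrite /bd -scalemxAr -scalemxAl scalerDr !scalerA [_ ^+ p * _]mulrC.
Qed.

Lemma d_hdefect j p : d p.+1 *m hdefect j p.+2 = hdefect j p.+1 *m d p.+1.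
Proof.
rewrite /hdefect !mulmxBr !mulmxBl !mulmxA dd mul0mx subr0.
rewrite -[(h j p *m d p) *m _]mulmxA dd mulmx0 subr0.
by rewrite mul_mx_scalar mul_scalar_mx.
Qed.

(** If [p + q < 2 a], then one of [p], [q] is below [a]. *)
Lemma hdefect_killed j X l p q : placed l X -> (l < a + a)%N ->
  hdefect j p *m X p q *m (hdefect j q)^T = 0.
Proof.
move=> pX la; case: (pX p q) => [->|[pa qa pq]]; first by rewrite mulmx0 mul0mx.
have [lt|ge] := ltnP p a; first by rewrite h_htpy // !mul0mx.
by rewrite [X in _ *m X^T]h_htpy ?trmx0 ?mulmx0 //; lia.
Qed.

(** Multiplication by [x_j ^ 2s] is null-homotopic below total degree [2 a]. *)
Lemma htpy_bd j X l p q : placed l X -> (l < a + a)%N ->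
  bd (htpy j X) p q = 'X_j ^+ (s + s) *: X p q - htpy j (bd X) p q.
Proof.
case: p => [|p]; first by move=> *; apply: empty_rows.
case: q => [|q]; first by move=> *; apply: empty_cols.
move=> pX la; have := hdefect_killed j p.+1 q.+1 pX la.
set P := hdefect j p.+1; set P' := hdefect j q.+1; set x : S := 'X_j ^+ s => kill.
have B : d p.+1 *m h j p.+1 + h j p *m d p = x%:M - P.
  by rewrite /P /hdefect -addrA -opprD subKr.
have C : (h j q.+1)^T *m (d q.+1)^T + (d q)^T *m (h j q)^T = x%:M - P'^T.
  rewrite -!trmx_mul -linearD /=.
  have -> : d q.+1 *m h j q.+1 + h j q *m d q = x%:M - P'.
    by rewrite /P' /hdefect -addrA -opprD subKr.
  by rewrite linearB /= tr_scalar_mx.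
rewrite exprD; apply/eqP; rewrite eq_sym subr_eq; apply/eqP; symmetry.
exact: htpy_identity B C (d_hdefect j p) kill.
Qed.

Lemma hdefect_deg j p : indegmx true s (hdefect j p).
Proof.
case: p => [|p]; first exact: indegmx0.
rewrite /hdefect; apply: indegmxD; first apply: indegmxD.
- exact/indegmx_scalar/indeg_var_pow.
- apply: indegmxN; have -> : s%:Z = (t p.+2 - t p.+1) + (s%:Z + t p.+1 - t p.+2) by lia.
  exact: indegmxM.
- apply: indegmxN; have -> : s%:Z = (s%:Z + t p - t p.+1) + (t p.+1 - t p) by lia.
  exact: indegmxM.
Qed.

Lemma htpy_placed j l X : placed l X -> placed l.+1 (htpy j X).
Proof.
move=> pX [|p] [|q]; try by left.
have [lpa|pa] := ltnP p a; last first.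
  rewrite /htpy h_top // mul0mx scaler0 add0r.
  case: (pX p.+1 q) => [->|[]]; last by lia.
  by left; rewrite mulmx0 mul0mx scaler0.
have [lqa|qa] := ltnP q a; last first.
  rewrite /htpy [h j q]h_top // trmx0 mulmx0 scaler0 addr0.
  case: (pX p q.+1) => [->|[]]; last by lia.
  by left; rewrite mulmx0 scaler0.
rewrite /htpy; case: (pX p q.+1) => [->|[*]]; last by right; split; lia.
case: (pX p.+1 q) => [->|[*]]; last by right; split; lia.
by left; rewrite !mulmx0 mul0mx !scaler0 addr0.
Qed.

Lemma htpy_deg j e X : indegfam e X -> indegfam (e + (s + s)%:Z) (htpy j X).
Proof.
move=> hX [|p] [|q]; try exact: indegmx0.
have hx := @indeg_var_pow K _ j s.
rewrite /htpy; apply: indegmxD.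
  have -> : e + (s + s)%:Z - t p.+1 - t q.+1
     = s%:Z + ((s%:Z + t p - t p.+1) + (e - t p - t q.+1)) by lia.
  by apply: indegmxZ => //; apply: indegmxM.
apply: indegmx_sign.
have -> : e + (s + s)%:Z - t p.+1 - t q.+1
     = (s%:Z + (e - t p.+1 - t q)) + (s%:Z + t q - t q.+1) by lia.
by do 2?apply: indegmxM => //; [exact: hdefect_deg | exact: indegmxT].
Qed.

Lemma htpy_pow j k X : powfam k X -> powfam k (htpy j X).
Proof.
move=> hX [|p] [|q]; try by move=> ? ?; rewrite mxE; apply: in_powers0.
apply: powmxD; apply: powmxZ; first exact: powmxM.
by apply: powmxMr; apply: powmxM.
Qed.

Lemma bd_pow k X : powfam k X -> powfam k (bd X).
Proof.
by move=> hX p q; apply: powmxD; [apply: powmxM | apply/powmxZ/powmxMr].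
Qed.

Fixpoint htpy_iter (z : bifamily) k : bifamily :=
  if k is k'.+1 then htpy (inord k') (htpy_iter z k') else z.

Section Chase.
Variables (z : bifamily) (l : nat).
Hypothesis pz : placed l z.
Hypothesis la : (l + n.+1 <= a + a)%N.
Hypothesis cz : forall p q, bd z p q = 0.

Lemma htpy_iter_placed k : placed (l + k) (htpy_iter z k).
Proof. by elim: k => [|k IH]; [rewrite addn0 | rewrite addnS; apply: htpy_placed]. Qed.

Lemma htpy_iter_deg e k : indegfam e z -> indegfam (e + (k * (s + s))%:Z) (htpy_iter z k).
Proof.
move=> hz; elim: k => [|k IH]; first by rewrite mul0n addr0.
by rewrite mulSn addnC PoszD addrA; apply: htpy_deg.
Qed.

(** With [Z_k] the [k]-th iterate,
    [bd Z_(k+1) = x_k ^ 2s Z_k - H_k (bd Z_k)], and [Z_0] is a cycle. *)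
Lemma bd_htpy_iter_pow k : (k <= n.+1)%N -> powfam k (bd (htpy_iter z k)).
Proof.
elim: k => [|k IH] kn; first by move=> p q i j; rewrite cz mxE; apply: in_powers0.
move=> p q; rewrite /= (htpy_bd _ _ _ (htpy_iter_placed k)); last by lia.
apply: powmxD.
  move=> i j; rewrite mxE mulrC; apply: in_powersM.
  by have := @in_powersX K n (s + s) (inord k); rewrite inordK.
apply: powmxN; apply: htpy_pow => p' q' i j; apply: (in_powersW (leqnSn k)).
by apply: IH; lia.
Qed.

(** Write [Z_(k+1) = bd b + x_k ^ 2s c + e] with [e] in the ideal of the first
    [k] powers. Applying [bd] and comparing with the formula for [bd Z_(k+1)]
    puts [x_k ^ 2s (Z_k - bd c)] in this ideal, and [x_k ^ 2s] is regular modulo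
    it. *)
Lemma chase_step k : (k < n.+1)%N ->
  (exists b, powfam k.+1 (fun p q => htpy_iter z k.+1 p q - bd b p q)) ->
  exists b, powfam k (fun p q => htpy_iter z k p q - bd b p q).
Proof.
move=> kn [b hb]; set j := inord k : 'I_n.+1.
have jk : j = k :> nat by rewrite inordK.
pose Y : bifamily := fun p q => htpy_iter z k.+1 p q - bd b p q.
pose c : bifamily := fun p q => map_mx (power_quot (s + s) j) (Y p q).
pose e : bifamily := fun p q => map_mx (power_rem (s + s) j) (Y p q).
have he : powfam k e by move=> p q; rewrite -jk; apply: powmx_rem; rewrite jk; apply: hb.
have YE p q : htpy_iter z k.+1 p q = bd b p q + ('X_j ^+ (s + s) *: c p q + e p q).
  by rewrite -powmx_divE /Y addrC subrK.
exists c => p q; rewrite -jk; apply: powmx_reg; rewrite jk.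
have lt : (l + k < a + a)%N by lia.
have E : bd (htpy_iter z k.+1) p q = 'X_j ^+ (s + s) *: bd c p q + bd e p q.
  rewrite (bd_add (A := bd b) (B := fun p q => 'X_j ^+ (s + s) *: c p q + e p q) p q YE).
  rewrite bd_bd add0r.
  rewrite (bd_add (A := fun p q => 'X_j ^+ (s + s) *: c p q) (B := e) p q (fun _ _ => erefl)).
  by rewrite bd_scale.
move: E; rewrite /= -/j (htpy_bd j _ _ (htpy_iter_placed k) lt) => E.
rewrite scalerBr; have -> : 'X_j ^+ (s + s) *: htpy_iter z k p q - 'X_j ^+ (s + s) *: bd c p q
   = htpy j (bd (htpy_iter z k)) p q + bd e p q.
  apply/eqP; rewrite subr_eq -addrA [bd e p q + _]addrC -E.
  by rewrite addrC subrK.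
apply: powmxD; last exact: bd_pow.
by apply: htpy_pow; apply: bd_htpy_iter_pow; lia.
Qed.

(** The bound on [t p + t q] says that the last iterate, of internal degree
    [e + 2 s (n + 1)], has coefficients of degree greater than
    [(2 s - 1) (n + 1)], so it lies in the ideal of all the powers; [chase_step]
    then descends to [Z_0 = z], modulo the ideal of no power at all. *)
Theorem cycle_is_boundary (e : int) : indegfam e z ->
  (forall p q, (p <= a)%N -> (q <= a)%N -> (p + q)%N = (l + n.+1)%N ->
     (0 < p)%N -> (0 < q)%N -> t p + t q < e + n.+1%:Z) ->
  exists b, forall p q, z p q = bd b p q.
Proof.
move=> hz deg.
suff [b hb] : exists b, powfam 0 (fun p q => htpy_iter z 0 p q - bd b p q).
  exists b => p q; apply/eqP; rewrite -subr_eq0; apply/eqP/matrixP => i j.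
  by rewrite [RHS]mxE; apply: in_powers_leq0 (hb p q i j).
suff: forall m, (m <= n.+1)%N ->
    exists b, powfam (n.+1 - m) (fun p q => htpy_iter z (n.+1 - m) p q - bd b p q).
  by move/(_ n.+1 (leqnn _)); rewrite subnn.
elim=> [_|m IH mn]; last first.
  apply: chase_step; first by lia.
  have -> : (n.+1 - m.+1).+1 = (n.+1 - m)%N by lia.
  by apply: IH; apply: ltnW.
rewrite subn0; exists (fun p q => 0) => p q i j.
rewrite /bd !mulmx0 mul0mx scaler0 addr0 subr0.
case: (htpy_iter_placed n.+1 p q) => [->|[pa qa pq]].
  by rewrite mxE; apply: in_powers0.
have pos m x : (x < r m)%N -> (0 < m)%N by case: m => //; rewrite r0.
have [p0 q0] := (pos _ _ (ltn_ord i), pos _ _ (ltn_ord j)).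
apply: in_powers_deg => m mz; have /eqP E := htpy_iter_deg (k := n.+1) hz mz.
have := deg p q pa qa pq p0 q0; lia.
Qed.

End Chase.
End TensorSquare.

(** * Vanishing of Tor for a resolution with a long linear part *)

Lemma factor_cols (R : comNzRingType) m k l (B : 'M[R]_(m, k)) (V : 'M_(m, l)) :
  (forall j, exists w, col j V = B *m w) -> exists W, V = B *m W.
Proof.
move=> /fin_all_exists[w hw].
exists (\matrix_(i, j) w j i 0); apply/matrixP => i j.
have /matrixP/(_ i 0) := hw j; rewrite !mxE => ->.
by apply: eq_bigr => k' _; rewrite mxE.
Qed.

Lemma exact_at_mx (R : comNzRingType) m k p l (A : 'M[R]_(m, k)) (B : 'M_(k, p))
    (V : 'M_(k, l)) :
  exact_at A B -> A *m V = 0 -> exists W, V = B *m W.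
Proof.
by move=> ex AV; apply: factor_cols => j; apply/ex; rewrite colE mulmxA AV mul0mx.
Qed.

Lemma exact_at_comp (R : comNzRingType) m k p (A : 'M[R]_(m, k)) (B : 'M_(k, p)) :
  exact_at A B -> A *m B = 0.
Proof.
move=> ex; apply/matrixP => i j; have /ex : exists w, col j B = B *m w.
  by exists (delta_mx j 0); rewrite colE.
by move/matrixP => /(_ i 0); rewrite colE mulmxA -colE !mxE.
Qed.

Lemma trmx11 (R : Type) (A : 'M[R]_1) : A^T = A.
Proof. by apply/matrixP => i j; rewrite mxE !ord1. Qed.

Section Resolution.
Variables (K : fieldType) (n d : nat).
Local Notation S := {mpoly K[n.+1]}.
Variables (I : S -> Prop) (F : free_complex K n.+1).
Hypothesis res : minimal_free_resolution I F.
Hypothesis lin : forall i, (i <= uphalf n.+1)%N -> forall j, @gdeg _ _ F i j = (d + i)%N.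
Hypothesis rad : forall i, radical I 'X_i.

(** The resolution of [S / I], shifted by one: [S] in degree 1, the generators
    of [I] in degree 2, their syzygies in degree 3. *)
Definition rk p := match p with 0 => 0%N | 1 => 1%N | q.+2 => rank F q end.

(** The degree of the generators in degree [p], valid in the linear part. *)
Definition shift p : int := match p with 0 | 1 => 0 | q.+2 => (d + q)%:Z end.

Definition dif p : 'M[S]_(rk p, rk p.+1) :=
  match p return 'M[S]_(rk p, rk p.+1) with
  | 0 => 0
  | 1 => aug F
  | q.+2 => diff F q
  end.

(** The last degree of the linear part. *)
Definition top := (uphalf n.+1).+2.

Definition tdif p : 'M[S]_(rk p, rk p.+1) := if (p < top)%N then dif p else 0.

Lemma dif_exact p : exact_at (dif p.+1) (dif p.+2).
Proof. by case: res => _ _ ex0 ex _; case: p => [|p]; [exact: ex0 | exact: ex]. Qed.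

Lemma dif_dif p : dif p *m dif p.+1 = 0.
Proof.
by case: p => [|p]; [rewrite mul0mx | apply: exact_at_comp; apply: dif_exact].
Qed.

Lemma tdif_tdif p : tdif p *m tdif p.+1 = 0.
Proof.
rewrite /tdif; case: ifP => _; rewrite ?mul0mx //.
by case: ifP => _; rewrite ?mulmx0 ?dif_dif.
Qed.

Lemma dif_deg p : (p < top)%N -> indegmx true (shift p.+1 - shift p) (dif p).
Proof.
case: res => -[gaug gdif] _ _ _ _.
case: p => [|[|p]] lt; first exact: indegmx0.
  by move=> i j m /gaug; rewrite lin //=; lia.
move: lt; rewrite /top 2!ltnS => lt i j m /gdif; rewrite !lin ?(ltnW lt) //.
by rewrite /shift; lia.
Qed.

Lemma tdif_deg p : indegmx true (shift p.+1 - shift p) (tdif p).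
Proof. by rewrite /tdif; case: ifP => [/dif_deg|_] //; apply: indegmx0. Qed.

Lemma resI p : I p <-> exists w, p%:M = aug F *m w.
Proof. by case: res. Qed.

Lemma aug_deg : indegmx true d (aug F).
Proof. by have := @dif_deg 1; rewrite /= addn0 subr0; apply. Qed.

Lemma resI_deg e p : I p -> indeg true (d%:Z + e) p ->
  exists2 w, indegmx true e w & p%:M = aug F *m w.
Proof.
move=> /resI[w E] hp; apply: (indegmx_factor (c := d) _ _ E).
  exact: aug_deg.
exact: indegmx_scalar.
Qed.

Lemma resI_mul p q : I p -> I (q * p).
Proof.
by move=> /resI[w E]; apply/resI; exists (q *: w); rewrite -scalemxAr -E scale_scalar_mx.
Qed.

Lemma uniform_power : exists s, forall j : 'I_n.+1, I ('X_j ^+ s).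
Proof.
have /fin_all_exists[s hs] : forall j, exists s, I ('X_j ^+ s) by exact: rad.
exists (\sum_j s j)%N => j; rewrite (bigD1 j) //= addnC exprD.
exact: resI_mul.
Qed.

Section Homotopy.
Variables (s : nat) (j : 'I_n.+1).
Hypothesis Ixs : I ('X_j ^+ s).

(** The homotopy for [x_j ^ s] is built one degree at a time: it starts with
    [x_j ^ s] as a combination of the generators of [I], and goes on because
    [x_j ^ s - h d] takes values in cycles. *)
Lemma homotopy_extend b : (b <= top)%N -> exists h : forall p, 'M[S]_(rk p.+1, rk p),
  [/\ forall p, (b <= p)%N -> h p = 0,
      forall p, indegmx true (s%:Z + shift p - shift p.+1) (h p)
    & forall p, (p.+1 < b)%N ->
      ('X_j ^+ s)%:M - dif p.+1 *m h p.+1 - h p *m dif p = 0].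
Proof.
elim: b => [|b IH] bt.
  exists (fun p => 0); split=> [p _ //|p|p]; first exact: indegmx0.
  by [].
have [h [h0 hdeg hh]] := IH (ltnW bt).
case: b bt h h0 hdeg hh {IH} => [|b] bt h h0 hdeg hh.
  exists (fun p => 0); split=> [p _ //|p|p]; first exact: indegmx0.
  by [].
pose V := ('X_j ^+ s)%:M - h b *m dif b.
have Vdeg : indegmx true s V.
  apply: indegmxD; first exact/indegmx_scalar/indeg_var_pow.
  apply: indegmxN; have -> : s%:Z = (s%:Z + shift b - shift b.+1) + (shift b.+1 - shift b) by lia.
  by apply: indegmxM => //; apply: dif_deg; lia.
have [W0 VW0] : exists W, V = dif b.+1 *m W.
  case: (b) bt h h0 hdeg hh @V Vdeg => [|q] bt h h0 hdeg hh V Vdeg.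
    by have /resI[w E] := Ixs; exists w; rewrite -E /V mulmx0 subr0.
  apply: (exact_at_mx (@dif_exact q)).
  have := hh q (ltnSn _) => /(congr1 (fun A => A *m dif q.+1)).
  rewrite /V !mulmxBl mulmxBr mul0mx mul_scalar_mx mul_mx_scalar.
  by rewrite -!mulmxA dif_dif mulmx0 subr0.
have [W Wdeg VW] : exists2 W, indegmx true (s%:Z + shift b.+1 - shift b.+2) W
    & V = dif b.+1 *m W.
  apply: indegmx_factor VW0; first by apply: dif_deg; lia.
  by have -> : shift b.+2 - shift b.+1 + (s%:Z + shift b.+1 - shift b.+2) = s by lia.
exists (dfwith h W); split => p.
- case: (eqVneq b.+1 p) => [<-|ne lt]; first by rewrite ltnn.
  by rewrite dfwith_out // h0 //; lia.
- by case: (eqVneq b.+1 p) => [<-|ne]; rewrite ?dfwith_in // dfwith_out.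
- rewrite ltnS leq_eqVlt => /orP[/eqP [E]|lt]; last first.
    by rewrite !dfwith_out ?hh //; lia.
  rewrite E dfwith_in dfwith_out; last by lia.
  by rewrite addrAC -/V VW subrr.
Qed.

End Homotopy.

Local Notation tfamily := (@bifamily K n rk).

Hypothesis d_gt0 : (0 < d)%N.

(** In the grading shifted by one, total degree [l] computes [Tor_(l - 2)]. The
    condition on [e] is [e > 2 d - 2 + (l - 2)], where the right-hand side bounds
    the degree of the generators of [F_p (x) F_q], [p + q = l + n + 1], minus
    [n + 1]. The bound [l <= 4] keeps [l + n + 1] within [2 top]. *)
Theorem tdif_tensor_exact (z : tfamily) l e :
  placed top l z -> (l <= 4)%N -> indegfam shift e z ->
  (2 * d)%:Z + l%:Z < e + 4%:Z ->
  (forall p q, bd tdif z p q = 0) ->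
  exists b, forall p q, z p q = bd tdif b p q.
Proof.
move=> pz l4 hz dege cz.
have [s Is] := uniform_power.
have /fin_all_exists[h hP] := fun j => homotopy_extend (Is j) (leqnn top).
apply: (@cycle_is_boundary K n rk tdif top s h shift _ _ _ _ _ _ z l pz _ cz e hz) => //.
- exact: tdif_tdif.
- by move=> j p; case: (hP j) => + _ _; apply.
- move=> j [|p] lt; first by [].
  by rewrite /hdefect /tdif (ltnW lt) lt; case: (hP j) => _ _; apply.
- exact: tdif_deg.
- by move=> j p; case: (hP j).
- by rewrite /top; lia.
- move=> [|[|p]] [|[|q]] //= _ _; lia.
Qed.

(** The vanishing of [Tor_0(A, A) = A] in degree at least [2 d]. *)
Corollary high_degree_in_ideal p e : (2 * d <= e)%N -> indeg true e p -> I p.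
Proof.
move=> de hp.
pose z : tfamily := fun i j => match i, j return 'M_(rk i, rk j) with
  | 1, 1 => p%:M | _, _ => 0 end.
have [|||||b hb] := @tdif_tensor_exact z 2 e => //.
- by move=> [|[|i]] [|[|j]]; first [by left | by right; rewrite /top; split].
- move=> [|[|i]] [|[|j]] //=; try exact: indegmx0.
  by move=> i j; rewrite !ord1 mxE eqxx mulr1n !subr0.
- lia.
- move=> [|i] [|j]; try exact: (@empty_rows K n rk erefl); first exact: (@empty_cols K n rk erefl).
  by case: i => [|i]; rewrite /bd mulmx0 mul0mx scaler0 addr0.
apply/resI; exists (b 2 1%N - (b 1%N 2)^T).
have := hb 1%N 1%N; rewrite /bd /tdif /= => ->.
rewrite expr1 scaleN1r mulmxBr; congr (_ - _).
by rewrite -[LHS]trmx11 trmx_mul trmxK.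
Qed.

(** The vanishing of [Tor_1(A, A) = I / I^2] in degree [2 d]: if [p] is the
    combination of the generators with coefficients [g], then [(g, g^T)] is a
    cycle of the tensor square. *)
Corollary ideal_square_high p : I p -> indeg true (2 * d)%:Z p ->
  exists2 C : 'M[S]_(rank F 0), indegmx true 0 C & p%:M = aug F *m C *m (aug F)^T.
Proof.
move=> /resI_deg Ip hp; have [|g gdeg gE] := Ip d%:Z; first by rewrite -PoszD addnn -mul2n.
pose z : tfamily := fun i j => match i, j return 'M_(rk i, rk j) with
  | 2, 1 => g | 1, 2 => g^T | _, _ => 0 end.
have [|||||b hb] := @tdif_tensor_exact z 3 (2 * d)%N%:Z => //.
- by move=> [|[|[|i]]] [|[|[|j]]]; first [by left | by right; rewrite /top; split].
- move=> [|[|[|i]]] [|[|[|j]]] //=; try exact: indegmx0.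
    by rewrite (_ : _ - _ - _ = d%:Z); [exact: indegmxT | lia].
  by rewrite (_ : _ - _ - _ = d%:Z); [| lia].
- lia.
- move=> [|[|i]] [|[|j]];
    try exact: (@empty_rows K n rk erefl); try exact: (@empty_cols K n rk erefl).
  + rewrite /bd /tdif /= expr1 scaleN1r.
    by rewrite -[X in _ - X]trmx11 trmx_mul !trmxK subrr.
  + by case: j => [|j]; rewrite /bd mulmx0 mul0mx scaler0 addr0.
  + by case: i => [|i]; rewrite /bd mulmx0 mul0mx scaler0 addr0.
  + by case: i j => [|i] [|j]; rewrite /bd mulmx0 mul0mx scaler0 addr0.
have := hb 2 1%N; rewrite /bd /tdif /= => gb.
have E : p%:M = aug F *m b 2 2 *m (aug F)^T.
  rewrite gE gb mulmxDr mulmxA (exact_at_comp (@dif_exact 0)) mul0mx add0r.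
  by rewrite expr2 mulrNN mulr1 scale1r mulmxA.
have [B [C [bE hB hC]]] := indegmx_split 0 (b 2 2).
exists B => //; apply/eqP; rewrite -subr_eq0; apply/eqP.
apply: (@indegmx_true_false _ _ (2 * d)%N%:Z).
  apply: indegmxD.
    exact: indegmx_scalar.
  apply: indegmxN; have -> : (2 * d)%N%:Z = d%:Z + 0 + d%:Z by lia.
  by apply: indegmxM; [apply: indegmxM => //; apply: aug_deg | apply/indegmxT/aug_deg].
rewrite E bE mulmxDr mulmxDl addrAC subrr add0r.
have -> : (2 * d)%N%:Z = d%:Z + 0 + d%:Z by lia.
by apply: indegmxMr; [apply: indegmxM => //; apply: aug_deg | apply/indegmxT/aug_deg].
Qed.

(** The vanishing of [Tor_2(A, A)] in degree [2 d + 1]: [Y] completes to a cycle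
    of the tensor square because [Y aug^T] and [Y^T aug^T] are syzygies of the
    generators. *)
Corollary linear_relations (Y : 'M[S]_(rank F 0)) :
  indegmx true 1 Y -> aug F *m Y *m (aug F)^T = 0 ->
  exists W W', Y = diff F 0 *m W + W' *m (diff F 0)^T.
Proof.
move=> hY Y0.
have liftY (X : 'M[S]_(rank F 0)) : indegmx true 1 X -> aug F *m X *m (aug F)^T = 0 ->
    exists2 W : 'cV_(rank F 1), indegmx true d W & X *m (aug F)^T = diff F 0 *m W.
  move=> hX; rewrite -mulmxA => /(exact_at_mx (@dif_exact 0))[W0 E].
  apply: (indegmx_factor (c := 1)) E.
    by have := @dif_deg 2; rewrite /= (_ : _ - _ = 1); [apply | lia].
  by apply: indegmxM => //; apply/indegmxT/aug_deg.
have [U hU UE] := liftY Y hY Y0.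
have [|U' hU' UE'] := liftY Y^T (indegmxT hY).
  by rewrite -[LHS]trmx11 !trmx_mul !trmxK mulmxA.
pose z : tfamily := fun i j => match i, j return 'M_(rk i, rk j) with
  | 2, 2 => Y | 3, 1 => - U | 1, 3 => U'^T | _, _ => 0 end.
have [|||||b hb] := @tdif_tensor_exact z 4 (2 * d + 1)%N%:Z => //.
- by move=> [|[|[|[|i]]]] [|[|[|[|j]]]]; first [by left | by right; rewrite /top; split].
- move=> [|[|[|[|i]]]] [|[|[|[|j]]]] //=; try exact: indegmx0.
  + by rewrite (_ : _ - _ - _ = d%:Z); [exact: indegmxT | lia].
  + by rewrite (_ : _ - _ - _ = 1); [| lia].
  + by rewrite (_ : _ - _ - _ = d%:Z); [exact: indegmxN | lia].
- lia.
- move=> [|[|[|i]]] [|[|[|j]]];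
    try exact: (@empty_rows K n rk erefl); try exact: (@empty_cols K n rk erefl);
    try by rewrite /bd mulmx0 mul0mx scaler0 addr0.
  + rewrite /bd /tdif /= expr1 scaleN1r.
    by rewrite -trmx_mul -UE' trmx_mul !trmxK subrr.
  + by rewrite /bd /tdif /= expr2 mulrNN mulr1 scale1r UE mulmxN addNr.
  + by case: i => [|i]; rewrite /bd mulmx0 mul0mx scaler0 addr0.
  + by case: i => [|i]; rewrite /bd mulmx0 mul0mx scaler0 addr0.
  + by case: i j => [|i] [|j]; rewrite /bd mulmx0 mul0mx scaler0 addr0.
have := hb 2 2; rewrite /bd /tdif /= => ->.
by rewrite expr2 mulrNN mulr1 scale1r; exists (b 3 2), (b 2 3).
Qed.

End Resolution.

(** * Linear forms and linear series *)

Section LinearForms.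
Variables (K : fieldType) (n : nat).
Local Notation S := {mpoly K[n]}.

Definition vars : 'rV[S]_n := \row_k 'X_k.

Lemma var_deg k : indeg true 1 ('X_k : S).
Proof. by have := @indegX K _ U_(k)%MM; rewrite mdeg1. Qed.

Definition linform (a : 'I_n -> K) : S := \sum_k a k *: 'X_k.

Lemma linform_deg a : indeg true 1 (linform a).
Proof.
by apply: indeg_sum => k _; apply/indegZ/var_deg.
Qed.

Lemma linform_coef a k : (linform a)@_U_(k) = a k.
Proof.
rewrite /linform raddf_sum /= (bigD1 k) //= mcoeffZ mcoeffX eqxx mulr1 big1 ?addr0 //.
by move=> i ik; rewrite mcoeffZ mcoeffXU (negbTE ik) mulr0.
Qed.

Lemma var_decomp (t : nat) (p : S) : indeg true t.+1 p ->
  exists2 u : 'cV[S]_n, indegmx true t u & p%:M = vars *m u.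
Proof.
move=> hp; rewrite [p]mpolyE.
have : {subset msupp p <= msupp p} by [].
elim: {1 3}(msupp p) => [|m r IH] sub.
  by exists 0; [exact: indegmx0 | rewrite big_nil mulmx0 raddf0].
have [|u hu uE] := IH; first by move=> x xr; apply: sub; rewrite inE xr orbT.
have /eqP[mt] : (mdeg m)%:Z == t.+1 by rewrite (hp m) // sub ?mem_head.
have [k mk] : exists k, (0 < m k)%N.
  apply/existsP; rewrite -[[exists _, _]]negbK negb_exists; apply/forallP => m0.
  suff : mdeg m = 0%N by rewrite mt.
  by rewrite mdegE big1 // => i _; have := m0 i; lia.
have mE : m = (U_(k) + (m - U_(k)))%MM.
  apply/mnmP => l; rewrite mnmDE mnmBE mnm1E.
  by case: eqVneq => [<-|_] /=; [rewrite subnKC | rewrite subn0].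
pose e : 'cV[S]_n := \col_i (if i == k then p@_m *: 'X_[m - U_(k)] else 0).
exists (e + u).
  apply: indegmxD => // i j; rewrite mxE; case: ifP => _; last exact: indeg0.
  apply: indegZ; have := @indegX K _ (m - U_(k))%MM.
  have := congr1 mdeg mE; rewrite mdegD mdeg1 mt add1n => -[->]; exact.
rewrite big_cons raddfD /= uE mulmxDr; congr (_ + _).
apply/matrixP => i j; rewrite !ord1 !mxE eqxx mulr1n.
rewrite (bigD1 k) //= !mxE eqxx big1 ?addr0; last first.
  by move=> l lk; rewrite !mxE (negbTE lk) mulr0.
by rewrite -scalerAr -mpolyXD -mE.
Qed.

Lemma linform_of (p : S) : indeg true 1 p -> p = linform (fun k => p@_U_(k)).
Proof.
move=> /(@var_decomp 0)[u hu uE].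
have {uE} pE : p = linform (fun k => (u k 0)@_0).
  have /matrixP/(_ 0 0) := uE; rewrite !mxE eqxx mulr1n => ->.
  by apply: eq_bigr => k _; rewrite mxE {1}(indeg_const (hu k 0)) mulrC mul_mpolyC.
by rewrite {1}pE; apply: eq_bigr => k _; rewrite [in RHS]pE linform_coef.
Qed.

Lemma const_map_deg r s (A : 'M[K]_(r, s)) : indegmx true 0 (map_mx (@mpolyC n K) A).
Proof. by move=> i j; rewrite mxE; apply: indegC. Qed.

Lemma const_of r s (A : 'M[S]_(r, s)) : indegmx true 0 A ->
  exists A0 : 'M[K]_(r, s), A = map_mx (@mpolyC n K) A0.
Proof.
move=> hA; exists (map_mx (fun p : S => p@_0) A).
by apply/matrixP => i j; rewrite !mxE {1}(indeg_const (hA i j)).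
Qed.

End LinearForms.
Arguments const_map_deg {K} n {r s} A.

Section Series.
Variables (K : fieldType) (n d N : nat).
Local Notation S := {mpoly K[n.+1]}.
Variables (V : {vspace dhomog n.+1 K d}) (f : N.-tuple (dhomog n.+1 K d)).
Hypothesis basis_f : basis_of V f.

Local Notation fr := (forms_row f).

Lemma forms_deg : indegmx true d fr.
Proof. by move=> i j; rewrite mxE; apply/dhomog_indeg/dhomog_is_dhomog. Qed.

Lemma forms_comb (a : 'I_N -> K) :
  (\sum_i a i *: f`_i : dhomog n.+1 K d) = (fr *m \col_i (a i)%:MP) 0 0 :> S.
Proof.
rewrite (linear_sum (@mpoly_of_dhomog n.+1 K d)) mxE; apply: eq_bigr => i _.
by rewrite !mxE mulrC mul_mpolyC (tnth_nth 0).
Qed.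

Lemma forms_free (w : 'cV[S]_N) : indegmx true 0 w -> fr *m w = 0 -> w = 0.
Proof.
move=> /const_of[a ->] /matrixP/(_ 0 0); rewrite !mxE => fw.
have /freeP fr_f := basis_free basis_f.
have a0 i : a i 0 = 0.
  apply: (fr_f (fun i => a i 0)); apply: val_inj.
  rewrite [LHS]forms_comb [RHS](linear0 (@mpoly_of_dhomog n.+1 K d)) -fw mxE.
  by apply: eq_bigr => k _; rewrite !mxE.
by apply/matrixP => i j; rewrite !mxE !ord1 a0 mpolyC0.
Qed.

Lemma series_idealP p : series_ideal V p <-> exists w, p%:M = fr *m w.
Proof.
split=> [[m [c [a [aV ->]]]]|[w /matrixP/(_ 0 0)]]; last first.
  rewrite !mxE eqxx mulr1n => ->; exists N, (fun i => w i 0), (fun i => fr 0 i).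
  split=> [i|]; last by apply: eq_bigr => i _; rewrite mulrC.
  exists (tnth f i); last by rewrite mxE.
  by rewrite (basis_mem basis_f) // mem_tnth.
have /fin_all_exists[b hb] : forall i, exists b : 'cV[S]_N, (a i)%:M = fr *m b.
  move=> i; have [v vV ->] := aV i.
  exists (\col_k (coord f k v)%:MP); apply/matrixP => x y.
  rewrite !ord1 -forms_comb -(coord_basis basis_f vV).
  by rewrite mxE eqxx mulr1n.
exists (\sum_i c i *: b i); rewrite mulmx_sumr raddf_sum /=; apply: eq_bigr => i _.
by rewrite -scalemxAr -hb scale_scalar_mx.
Qed.

(** If [d = 0], then the generators of [I] are constants, and they all vanish as
    [1] is not in [I]; but [I] contains a power of [x_0]. *)
Lemma series_degree_gt0 : base_point_free V -> (0 < d)%N.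
Proof.
move=> [[I1 _] rad]; rewrite lt0n; apply/eqP => d0.
have [|k] := (rad 'X_ord0).2.
  exists 1%N, (fun=> 1), (fun=> 'X_ord0); split; first by move=> _; exists ord0.
  by rewrite big_ord1 mul1r.
move=> /series_idealP[w wE].
have fr0 : fr = 0.
  apply/matrixP => i j; rewrite (ord1 i) [RHS]mxE; apply/eqP/negPn/negP => nz.
  apply: I1; apply/series_idealP.
  have dz : d%:Z = 0 by rewrite d0.
  have := @forms_deg 0 j; rewrite dz => /indeg_const fc.
  have cn : (fr 0 j)@_0 != 0 by apply: contraNneq nz => c0; rewrite fc c0.
  set c := (fr 0 j)@_0 in fc cn.
  exists (c^-1%:MP *: delta_mx j 0); apply/matrixP => x y.
  rewrite !ord1 -scalemxAr -colE [RHS]mxE [col j _ _ _]mxE fc -mpolyCM mulVf //.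
  by rewrite mxE eqxx.
move: wE => /matrixP/(_ 0 0); rewrite fr0 mul0mx !mxE eqxx mulr1n mpolyXn => /eqP.
by rewrite -msupp_eq0 msuppX.
Qed.

End Series.

(** * The tensor shared by the presentation matrix and its adjoint *)

Section TensorReadings.
Variables (K : fieldType) (n N M : nat).

Definition tensor_x (c : 'I_N -> 'I_M -> 'I_n -> K) : 'M[{mpoly K[n]}]_(N, M) :=
  \matrix_(i, j) linform (c i j).

Definition tensor_T (c : 'I_N -> 'I_M -> 'I_n -> K) : 'M[{mpoly K[N]}]_(n, M) :=
  \matrix_(k, j) linform (fun i => c i j k).

End TensorReadings.

Section Tensor.
Variables (K : fieldType) (n N M : nat).
Variables (phi : 'M[{mpoly K[n]}]_(N, M)) (psi : 'M[{mpoly K[N]}]_(n, M)).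

(** The entries of [psi] define [c]; the [i]-th row of [phi] is then recovered by
    the substitution [T := e_i] in [T phi = x psi]. *)
Lemma adjoint_tensor : adjoint_matrix phi psi ->
  exists c, phi = tensor_x c /\ psi = tensor_T c.
Proof.
move=> [psi_lin E]; exists (fun i j k => (psi k j)@_U_(i)); split; last first.
  by apply/matrixP => k j; rewrite mxE; apply: linform_of; apply: dhomog_indeg.
apply/matrixP => i j; rewrite [RHS]mxE.
(* The substitution T := e_i, which leaves x unchanged. *)
pose ev := comp_mpoly [tuple (match split z with
    | inl k => 'X_k | inr i' => (i' == i)%:R end : {mpoly K[n]}) | z < n + N].
have evx (p : {mpoly K[n]}) : ev (x_inj N p) = p.
  rewrite -[RHS]comp_mpoly_id [RHS]comp_mpolyE /x_inj [p \mPo _]comp_mpolyE.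
  rewrite /ev raddf_sum /=; apply: eq_bigr => m _.
  rewrite comp_mpolyZ rmorph_prod /=; congr (_ *: _); apply: eq_bigr => k _.
  rewrite rmorphXn /= !tnth_mktuple comp_mpolyXU -tnth_nth tnth_mktuple.
  by rewrite -[lshift N k]/(unsplit (inl k)) unsplitK.
have evT i' : ev (T_inj n 'X_i') = (i' == i)%:R.
  rewrite /T_inj comp_mpolyXU -tnth_nth tnth_mktuple /ev comp_mpolyXU -tnth_nth.
  by rewrite tnth_mktuple -[rshift n i']/(unsplit (inr i')) unsplitK.
have evL a : ev (T_inj n (linform a)) = (a i)%:MP.
  transitivity (\sum_i' a i' *: ev (T_inj n 'X_i')).
    rewrite /linform [T_inj _ _](raddf_sum (comp_mpoly _)) [LHS](raddf_sum (comp_mpoly _)).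
    by apply: eq_bigr => i1 _; rewrite /ev /T_inj /= !comp_mpolyZ.
  under eq_bigr do rewrite evT.
  rewrite (bigD1 i) //= eqxx -mul_mpolyC mulr1 big1 ?addr0 // => i' /negbTE ->.
  by rewrite scaler0.
have evM p q : ev (p * q) = ev p * ev q by exact: rmorphM.
have evS m (F : 'I_m -> _) : ev (\sum_z F z) = \sum_z ev (F z) by exact: raddf_sum.
have /matrixP/(_ 0 j) := E; rewrite !mxE => /(congr1 ev); rewrite !evS.
under eq_bigr => i' _ do rewrite !mxE evM evx evT.
rewrite (bigD1 i) //= eqxx mul1r big1 ?addr0; last first.
  by move=> i' /negbTE ->; rewrite mul0r.
move=> ->; apply: eq_bigr => k _; rewrite !mxE evM evx mulrC -mul_mpolyC.
congr (_ * _); rewrite {1}[psi k j]linform_of ?evL //; exact: dhomog_indeg.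
Qed.

End Tensor.

(** * From the symmetric algebra to the Rees algebra *)

Section SpecialFiber.
Variables (K : fieldType) (n d N M : nat).
Local Notation S := {mpoly K[n.+1]}.
Local Notation T := {mpoly K[N]}.
Variables (V : {vspace dhomog n.+1 K d}) (f : N.-tuple (dhomog n.+1 K d)).
Hypothesis basis_f : basis_of V f.
Hypothesis d_gt0 : (0 < d)%N.
Variables (phi : 'M[S]_(N, M)) (psi : 'M[T]_(n.+1, M)).
Variable c : 'I_N -> 'I_M -> 'I_n.+1 -> K.
Hypothesis phiE : phi = tensor_x c.
Hypothesis psiE : psi = tensor_T c.
Hypothesis phi_exact : exact_at (forms_row f) phi.

Local Notation fr := (forms_row f).
Local Notation ev := (comp_mpoly [tuple (tnth f i : S) | i < N]).
Local Notation X := (vars K n.+1).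
Local Notation Tv := (vars K N).

Lemma ev_vars : map_mx ev Tv = fr.
Proof. by apply/rowP => i; rewrite !mxE comp_mpolyXU -tnth_nth tnth_mktuple. Qed.

(** As [d > 0], distinct degrees stay distinct under [ev], hence [b]. *)
Lemma ev_deg b (t : nat) q : indeg b t q -> indeg b (d * t)%N (ev q).
Proof.
move=> hq; rewrite comp_mpolyE big_seq; apply: indeg_sum => m /hq mt; apply: indegZ.
have prod_deg (r : seq 'I_N) : indeg true (\sum_(i <- r) d * m i)%N
    (\prod_(i <- r) tnth [tuple (tnth f i : S) | i < N] i ^+ m i).
  elim: r => [|i r IH]; first by rewrite !big_nil; apply: (@indegC _ _ 1).
  rewrite !big_cons PoszD; apply: indegM => //; rewrite tnth_mktuple.
  by apply/dhomog_indeg/dhomogMn/dhomog_is_dhomog.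
move: (prod_deg (index_enum _)); rewrite -big_distrr -mdegE /= => h.
case: b mt {hq} => mt; first by move/eqP: mt => [<-].
by apply: indeg_neq h _; move/negbT: mt; rewrite !eqz_nat eqn_pmul2l.
Qed.

Lemma phi_deg : indegmx true 1 phi.
Proof. by move=> i j; rewrite phiE mxE; apply: linform_deg. Qed.

(** Both sides are the contraction of the tensor with [x] and [f]. *)
Lemma tensor_eval m (a : 'I_N -> 'I_m -> 'I_n.+1 -> K) :
  X *m map_mx ev (tensor_T a) = fr *m tensor_x a.
Proof.
apply/rowP => j; rewrite !mxE.
transitivity (\sum_k \sum_i a i j k *: ('X_k * fr 0 i)).
  apply: eq_bigr => k _; rewrite !mxE /linform raddf_sum /= mulr_sumr.
  apply: eq_bigr => i _; rewrite comp_mpolyZ -scalerAr; congr (_ *: (_ * _)).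
  by rewrite -ev_vars !mxE.
rewrite exchange_big /=; apply: eq_bigr => i _; rewrite !mxE /linform mulr_sumr.
by apply: eq_bigr => k _; rewrite -scalerAr mulrC.
Qed.

(** The contraction of the tensor with [u] in its second index. Multiplied by
    [T] it gives [psi u], evaluated at [f] it gives the syzygy [phi (ev u)]: to
    subtract it modifies a syzygy of the [f_i] without changing the class modulo
    the image of [psi]. *)
Definition contract (u : 'cV[T]_M) : 'M[T]_(n.+1, N) :=
  \matrix_(k, i) \sum_j c i j k *: u j 0.

Lemma contract_vars u : contract u *m Tv^T = psi *m u.
Proof.
rewrite psiE; apply/matrixP => k x; rewrite (ord1 x) !mxE.
under eq_bigr do rewrite !mxE mulr_suml.
rewrite exchange_big /=; apply: eq_bigr => j _.
rewrite !mxE /linform mulr_suml; apply: eq_bigr => i _.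
by rewrite -!scalerAl mulrC.
Qed.

Lemma contract_eval u : X *m map_mx ev (contract u) = (phi *m map_mx ev u)^T.
Proof.
rewrite phiE; apply/matrixP => x i; rewrite (ord1 x) !mxE.
under eq_bigr do rewrite !mxE raddf_sum /= mulr_sumr.
rewrite exchange_big /=; apply: eq_bigr => j _.
rewrite !mxE /linform mulr_suml; apply: eq_bigr => k _.
by rewrite comp_mpolyZ -scalerAr -scalerAl.
Qed.

Lemma vars_psi : X *m map_mx ev psi = fr *m phi.
Proof. by rewrite phiE psiE tensor_eval. Qed.

(** By [vars_psi], [x (ev psi) = f phi = 0], so [p e_0 = psi w] gives
    [x_0 ev p = 0]. *)
Lemma ann_coker_image p : ann_coker psi p -> image_ideal f p.
Proof.
move=> /(_ (delta_mx ord0 0))[w /(congr1 (map_mx ev))].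
rewrite map_mxM => /(congr1 (mulmx X)).
rewrite mulmxA vars_psi (exact_at_comp phi_exact) mul0mx.
move=> /matrixP/(_ 0 0); rewrite !mxE (bigD1 ord0) //= big1 ?addr0; last first.
  by move=> k k0; rewrite !mxE (negbTE k0) mulr0 comp_mpoly0 mulr0.
rewrite !mxE eqxx mulr1 => /eqP; rewrite mulf_eq0 => /orP[|/eqP //].
by rewrite -msupp_eq0 msuppX.
Qed.

Section Resolution.
Variable F : free_complex K n.+1.
Hypothesis res : minimal_free_resolution (series_ideal V) F.
Hypothesis lin : forall i, (i <= uphalf n.+1)%N ->
  forall j, @gdeg _ _ F i j = (d + i)%N.
Hypothesis rad : forall i, radical (series_ideal V) 'X_i.

(** The generators in the given resolution and the basis [f] of [V] both
    generate [I] in the single degree [d], hence are related by constants. *)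
Lemma aug_of_forms : exists P : 'M[K]_(N, rank F 0),
  aug F = fr *m map_mx (@mpolyC n.+1 K) P.
Proof.
have [P PE] : exists P, aug F = fr *m P.
  apply: factor_cols => j.
  have /(series_idealP basis_f)[w wE] : series_ideal V (aug F 0 j).
    apply/(resI res); exists (delta_mx j 0).
    by apply/matrixP => x y; rewrite !ord1 -colE !mxE eqxx mulr1n.
  by exists w; rewrite -wE; apply/matrixP => x y; rewrite !ord1 !mxE eqxx mulr1n.
have [|P' hP' P'E] := indegmx_factor (c := d) (c' := 0) (@forms_deg _ _ _ _ f) _ PE.
  by rewrite addr0; exact: (aug_deg res lin).
by have [P0 P0E] := const_of hP'; exists P0; rewrite -P0E.
Qed.

Lemma forms_of_aug : exists Q : 'M[S]_(rank F 0, N), indegmx true 0 Q /\ fr = aug F *m Q.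
Proof.
have [Q QE] : exists Q, fr = aug F *m Q.
  apply: factor_cols => j; have /(resI res)[w wE] : series_ideal V (fr 0 j).
    apply/(series_idealP basis_f); exists (delta_mx j 0).
    by apply/matrixP => x y; rewrite !ord1 -colE !mxE eqxx mulr1n.
  by exists w; rewrite -wE; apply/matrixP => x y; rewrite !ord1 !mxE eqxx mulr1n.
have [|Q' hQ' Q'E] := indegmx_factor (c := d) (c' := 0) (aug_deg res lin) _ QE.
  by rewrite addr0; exact: forms_deg.
by exists Q'.
Qed.

(** For [t = 2] this is [S_(2d) = V^2]; then [S_(d (t + 1)) = V S_(d t)], as
    [I] contains all forms of degree at least [2 d]. *)
Lemma ev_surj (t : nat) g : (2 <= t)%N -> indeg true (d * t)%N g ->
  exists2 u : T, indeg true t u & ev u = g.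
Proof.
move=> t2; have [P PE] := aug_of_forms.
have map_const r s (A : 'M[K]_(r, s)) :
    map_mx ev (map_mx (@mpolyC N K) A) = map_mx (@mpolyC n.+1 K) A.
  by apply/matrixP => i j; rewrite !mxE comp_mpolyC.
have Tv_deg : indegmx true 1 Tv by move=> i j; rewrite mxE; apply: var_deg.
elim: t t2 g => // t IH t2 g hg.
have Ig : series_ideal V g.
  by apply: (high_degree_in_ideal res lin rad d_gt0 _ hg); rewrite mulnC leq_mul2l t2 orbT.
have [t1|t1] := leqP t 1.
  have tE : t.+1 = 2%N by lia.
  rewrite tE mulnC in hg *.
  have [C /const_of[C0 ->] CE] := ideal_square_high res lin rad d_gt0 Ig hg.
  pose U := Tv *m map_mx (@mpolyC N K) (P *m C0 *m P^T) *m Tv^T.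
  have UE : map_mx ev U = g%:M.
    rewrite /U (map_mxM ev) (map_mxM ev) -map_trmx ev_vars map_const CE PE trmx_mul.
    by rewrite !map_mxM -map_trmx !mulmxA.
  exists (U 0 0); last first.
    by have /matrixP/(_ 0 0) := UE; rewrite !mxE eqxx mulr1n.
  suff h : indegmx true (1 + 0 + 1) U by exact: (h 0 0).
  apply: indegmxM; last exact: indegmxT.
  by apply: indegmxM => //; apply: const_map_deg.
have /(series_idealP basis_f)[w0 wE0] := Ig.
have [|w hw wE] := indegmx_factor (c := d) (c' := (d * t)%N) (@forms_deg _ _ _ _ f) _ wE0.
  by rewrite -PoszD -mulnS; apply: indegmx_scalar.
have /fin_all_exists2[u hu uE] : forall i, exists2 u : T, indeg true t u & ev u = w i 0.
  by move=> i; apply: IH.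
pose U := Tv *m \col_i u i.
exists (U 0 0).
  suff h : indegmx true (1 + t%:Z) U by exact: (h 0 0).
  by apply: indegmxM => // i j; rewrite mxE.
have UE : map_mx ev U = g%:M.
  rewrite /U (map_mxM ev) ev_vars wE; congr (_ *m _).
  by apply/matrixP => i j; rewrite !mxE /= uE !ord1.
by have /matrixP/(_ 0 0) := UE; rewrite !mxE eqxx mulr1n.
Qed.

(** [linear_relations] read in the basis [f] and with the syzygies [phi] instead
    of those of the given resolution. *)
Lemma linear_relations_phi (L : 'M[S]_N) :
  indegmx true 1 L -> fr *m L *m fr^T = 0 ->
  exists W W' : 'M[K]_(M, N), L = phi *m map_mx (@mpolyC n.+1 K) W
    + (phi *m map_mx (@mpolyC n.+1 K) W')^T.
Proof.
move=> hL L0; have [P PE] := aug_of_forms; have [Q [hQ QE]] := forms_of_aug.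
move: {P} (map_mx _ P) PE (const_map_deg n.+1 P) => P PE hP.
have PQ : P *m Q = 1%:M.
  apply/eqP; rewrite -subr_eq0; apply/eqP/matrixP => i j.
  have : col j (P *m Q - 1%:M) = 0.
    apply: (forms_free basis_f).
      move=> x y; rewrite mxE; move: x j {y}; apply: indegmxD.
        exact: (indegmxM hP hQ).
      exact/indegmxN/indegmx_scalar/(@indegC _ _ 1).
    by rewrite colE mulmxA mulmxBr mulmxA -PE -QE mulmx1 subrr mul0mx.
  by move/matrixP/(_ i 0); rewrite !mxE.
have [R RE] : exists R, P *m diff F 0 = phi *m R.
  apply: exact_at_mx phi_exact _; rewrite mulmxA -PE.
  exact: exact_at_comp (@dif_exact _ _ _ _ res 0).
have [||W [W' Y]] := linear_relations res lin rad d_gt0 (Y := Q *m L *m Q^T).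
- by have := indegmxM (indegmxM hQ hL) (indegmxT hQ); rewrite addr0 add0r.
- by rewrite !mulmxA -QE -mulmxA -trmx_mul -QE.
have LE : L = phi *m (R *m W *m P^T) + (phi *m (R *m W'^T *m P^T))^T.
  have -> : L = P *m (Q *m L *m Q^T) *m P^T.
    by rewrite !mulmxA PQ mul1mx -mulmxA -trmx_mul PQ trmx1 mulmx1.
  rewrite Y mulmxDr mulmxDl !mulmxA RE; congr (_ + _).
  by rewrite -RE !trmx_mul !trmxK !mulmxA -!mulmxA.
have [W0 [W1 [WE hW0 hW1]]] := indegmx_split 0 (R *m W *m P^T).
have [W0' [W1' [WE' hW0' hW1']]] := indegmx_split 0 (R *m W'^T *m P^T).
have [A AE] := const_of hW0; have [A' AE'] := const_of hW0'.
exists A, A'; rewrite -AE -AE'; apply/eqP; rewrite -subr_eq0; apply/eqP.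
have phiM b (B : 'M_(M, N)) : indegmx b 0 B -> indegmx b 1 (phi *m B).
  by move=> hB; have := indegmxM phi_deg hB; rewrite addr0.
apply: (@indegmx_true_false _ _ 1).
  apply: indegmxD => //; apply/indegmxN/indegmxD; first exact: phiM.
  by apply/indegmxT/phiM.
have -> : L - (phi *m W0 + (phi *m W0')^T) = phi *m W1 + (phi *m W1')^T.
  rewrite {1}LE WE WE' !mulmxDr linearD /= addrACA.
  by rewrite [LHS]addrAC subrr add0r.
by apply: indegmxD; [apply: phiM | apply/indegmxT/phiM].
Qed.

(** The part of degree 1 in [x] and [t >= 2] in [T] is the same in the symmetric
    algebra as in the Rees algebra. By induction on [t]: a factor [T_i] is split
    off, and the remaining factors, evaluated at [f], form a syzygy of the
    [f_i]. For [t = 2] a second factor is split off, since [ev] does not reach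
    all forms of degree [d]. *)
Lemma sym_rees_injective (t : nat) (v : 'cV[T]_(n.+1)) : (2 <= t)%N ->
  indegmx true t v -> X *m map_mx ev v = 0 -> exists w, v = psi *m w.
Proof.
have decomp t' (u : 'cV[T]_(n.+1)) : indegmx true t'.+1 u ->
    exists2 U : 'M[T]_(n.+1, N), indegmx true t' U & u = U *m Tv^T.
  move=> hu; have /fin_all_exists2[a ha aE] := fun k => var_decomp (hu k 0).
  exists (\matrix_(k, i) a k i 0); first by move=> k i; rewrite mxE; apply: ha.
  apply/matrixP => k j; rewrite (ord1 j).
  have /matrixP/(_ 0 0) := aE k; rewrite !mxE eqxx mulr1n => ->.
  by apply: eq_bigr => i _; rewrite !mxE mulrC.
elim: t v => // t IH v t2 /decomp[U hU vE] Xv.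
have U0 : fr *m (X *m map_mx ev U)^T = 0.
  rewrite -[LHS]trmx11 trmx_mul trmxK -mulmxA -ev_vars map_trmx -(map_mxM ev) -vE Xv.
  by [].
have [t1|t1] := leqP t 1.
  have tE : t = 1%N by lia.
  subst t.
  (* v_k = \sum_(l, i) e_lik T_l T_i; the matrix of linear forms of [e] is
     annihilated by f on both sides. *)
  pose e l i k := (U k i)@_U_(l).
  have UE : U = tensor_T e.
    by apply/matrixP => k i; rewrite mxE {1}[U k i]linform_of //; apply: hU.
  have [|| W [W' LE]] := linear_relations_phi (L := tensor_x e).
  - by move=> l i; rewrite mxE; apply: linform_deg.
  - by rewrite -tensor_eval -UE -[LHS]trmx11 trmx_mul trmxK.
  have eE l i k : e l i k = \sum_j c l j k * W j i + \sum_j c i j k * W' j l.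
    have /matrixP/(_ l i)/(congr1 (mcoeff U_(k))) := LE.
    rewrite !mxE linform_coef mcoeffD !raddf_sum /= => ->.
    by congr (_ + _); apply: eq_bigr => j _;
       rewrite !mxE phiE mxE mulrC mul_mpolyC mcoeffZ linform_coef mulrC.
  pose u := map_mx (@mpolyC N K) W' *m Tv^T.
  have {}UE : U = psi *m map_mx (@mpolyC N K) W + contract u.
    rewrite UE; apply/matrixP => k i; rewrite !mxE /linform.
    under eq_bigr do rewrite eE scalerDl !scaler_suml.
    rewrite big_split /= exchange_big [X in _ + X]exchange_big /=.
    congr (_ + _); apply: eq_bigr => j _; rewrite !mxE.
      rewrite psiE !mxE /linform mulr_suml; apply: eq_bigr => l _.
      by rewrite -scalerAl [in RHS]mulrC mul_mpolyC scalerA.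
    rewrite scaler_sumr; apply: eq_bigr => l _.
    by rewrite !mxE mul_mpolyC scalerA.
  exists (map_mx (@mpolyC N K) W *m Tv^T + u).
  by rewrite vE UE mulmxDl mulmxDr mulmxA contract_vars.
(* The columns of U satisfy the hypothesis only after correction by [contract u]. *)
have [w0 w0E] := exact_at_mx phi_exact U0.
have [|w hw wE] := indegmx_factor (c' := (d * t)%N) phi_deg _ w0E.
  apply/indegmxT/indegmxM; first by move=> x k; rewrite mxE; apply: var_deg.
  by move=> k i; rewrite mxE; apply/ev_deg/hU.
have /fin_all_exists2[u0 hu uE] : forall i, exists2 u : T, indeg true t u & ev u = w i 0.
  by move=> i; apply: ev_surj.
pose u : 'cV[T]_M := \col_i u0 i.
have {}uE : map_mx ev u = w by apply/matrixP => i j; rewrite !mxE uE (ord1 j).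
have [W WE] : exists W, U - contract u = psi *m W.
  apply: factor_cols => i; apply: IH => //.
    move=> k j; rewrite !mxE; apply: indegB; first exact: hU.
    by apply: indeg_sum => l _; apply: indegZ; rewrite mxE; apply: hu.
  rewrite map_col colE mulmxA (map_mxB ev) mulmxBr contract_eval uE -wE trmxK.
  by rewrite subrr mul0mx.
exists (W *m Tv^T + u).
by rewrite vE -[U](subrK (contract u)) WE mulmxDl mulmxDr mulmxA contract_vars.
Qed.

(** The kernel of [ev] is homogeneous, because the [f_i] have the same degree
    [d > 0]. *)
Lemma image_ann_coker p : image_ideal f p -> ann_coker psi p.
Proof.
suff homog_case (t : nat) q : indeg true t q -> ev q = 0 -> ann_coker psi q.
  move=> fp; have : forall m, m \in msupp p -> (mdeg m < msize p)%N.
    by move=> m; apply: msize_mdeg_lt.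
  move: (msize p) => b; elim: b p fp => [|b IH] p fp hp v.
    have -> : p = 0.
      by apply/msuppnil0; case E: (msupp p) (hp) => [//|m r] /(_ m); rewrite mem_head => /(_ isT).
    by exists 0; rewrite scale0r mulmx0.
  have [q [r [pE hq hr sub]]] := indeg_split b p.
  have q0 : ev q = 0.
    apply: (@indeg_true_false _ _ (d * b)%N); first exact: ev_deg.
    have -> : ev q = - ev r by apply/eqP; rewrite -addr_eq0 -raddfD -pE; apply/eqP.
    by apply/indegN/ev_deg.
  have [w1 E1] := homog_case b q hq q0 v.
  have [|m mr|w2 E2] := IH r _ _ v.
  - by move: fp; rewrite /image_ideal pE raddfD /= q0 add0r.
  - have := hp m (sub m mr); have := hr m mr; rewrite ltnS eqz_nat; lia.
  by exists (w1 + w2); rewrite pE scalerDl E1 E2 mulmxDr.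
move=> hq q0.
have [t2|t2] := leqP 2 t.
  move=> v; have [W WE] : exists W, q%:M = psi *m W.
    apply: factor_cols => k; apply: (sym_rees_injective t2).
      by move=> i j; rewrite mxE; apply: (indegmx_scalar hq).
    rewrite map_col colE mulmxA (map_scalar_mx ev) /= q0.
    by rewrite -scalemx1 scale0r mulmx0 mul0mx.
  by exists (W *m v); rewrite mulmxA -WE mul_scalar_mx.
suff -> : q = 0 by move=> v; exists 0; rewrite scale0r mulmx0.
case: t hq t2 => [|[|//]] hq _.
  by move: q0; rewrite (indeg_const hq) comp_mpolyC => /eqP; rewrite mpolyC_eq0 => /eqP ->.
move: q0; rewrite (linform_of hq) /linform raddf_sum /= => q0.
pose a : 'cV[S]_N := \col_i (q@_U_(i))%:MP.
have /matrixP a0 : a = 0.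
  apply: (forms_free basis_f) => [i j|]; first by rewrite mxE; apply: indegC.
  apply/matrixP => i j; rewrite !mxE -[RHS]q0; apply: eq_bigr => k _.
  by rewrite comp_mpolyZ -mul_mpolyC mulrC -ev_vars !mxE.
apply: big1 => i _; have /eqP := a0 i 0; rewrite !mxE mpolyC_eq0 => /eqP ->.
by rewrite scale0r.
Qed.

End Resolution.
End SpecialFiber.

Theorem corollary10p2 (K : fieldType) (n d N M : nat)
    (V : {vspace dhomog n.+1 K d}) (f : N.-tuple (dhomog n.+1 K d))
    (phi : 'M[{mpoly K[n.+1]}]_(N, M)) (psi : 'M[{mpoly K[N]}]_(n.+1, M)) :
  basis_of V f ->
  base_point_free V ->
  linear_for_steps d (uphalf n.+1) (series_ideal V) ->
  minimal_presentation d (forms_row f) phi ->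
  adjoint_matrix phi psi ->
  forall p : {mpoly K[N]}, ann_coker psi p <-> image_ideal f p.
Proof.
move=> basis_f bpf [F res lin] [_ phi_exact _ _] /adjoint_tensor[c [phiE psiE]] p.
split; first exact: (ann_coker_image phiE psiE phi_exact).
have rad i : radical (series_ideal V) 'X_i.
  apply/(bpf.2 'X_i); exists 1%N, (fun=> 1), (fun=> 'X_i).
  by split=> [_|]; [exists i | rewrite big_ord1 mul1r].
exact: (image_ann_coker basis_f (series_degree_gt0 basis_f bpf) phiE psiE phi_exact res lin rad).
Qed.
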